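(* There exist mm-spaces $X_n$ and $Y_n$, $n=1,2,\dots$, such that (1) $d_{\rm conc}(X_n,Y_n)$ is bounded away from zero (i.e. $\inf_n d_{\rm conc}(X_n,Y_n)>0$); (2) the associated pyramids $\mathcal{P}_{X_n}$ and $\mathcal{P}_{Y_n}$ both converge weakly to a common pyramid as $n\to\infty$.
   Context: An mm-space is a triple $(X,d_X,\mu_X)$ where $(X,d_X)$ is a complete separable metric space and $\mu_X$ is a Borel probability measure on $X$; it is always assumed that $X=\operatorname{supp}\mu_X$ (otherwise $X$ is replaced by $\operatorname{supp}\mu_X$). Two mm-spaces $X,Y$ are mm-isomorphic if there is an isometry $f:\operatorname{supp}\mu_X\to\operatorname{supp}\mu_Y$ with $f_*\mu_X=\mu_Y$. $\mathcal{X}$ denotes the set of mm-isomorphism classes of mm-spaces. Write $Y\prec X$ if there is a $1$-Lipschitz map $f:X\to Y$ with $f_*\mu_X=\mu_Y$. Let $I=[0,1)$ with Lebesgue measure $\mathcal{L}^1$. A parameter of $X$ is a Borel map $\varphi:I\to X$ with $\varphi_*\mathcal{L}^1=\mu_X$. The box distance $\square(X,Y)$ is the infimum of $\varepsilon\ge 0$ such that there are parameters $\varphi$ of $X$, $\psi$ of $Y$ and a Borel set $I_0\subset I$ with $\mathcal{L}^1(I_0)\ge 1-\varepsilon$ and $|d_X(\varphi(s),\varphi(t))-d_Y(\psi(s),\psi(t))|\le\varepsilon$ for all $s,t\in I_0$. For measurable $f,g:I\to\mathbb{R}$, $\operatorname{me}_{\mathcal{L}^1}(f,g)$ is the infimum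 of $\varepsilon\ge0$ with $\mathcal{L}^1(\{s\mid|f(s)-g(s)|>\varepsilon\})\le\varepsilon$. Let $\mathrm{Lip}_1(X)$ be the set of $1$-Lipschitz functions $X\to\mathbb{R}$ and $\varphi^*\mathrm{Lip}_1(X)=\{f\circ\varphi\mid f\in\mathrm{Lip}_1(X)\}$. The observable distance is $d_{\rm conc}(X,Y):=\inf_{\varphi,\psi}d_H(\varphi^*\mathrm{Lip}_1(X),\psi^*\mathrm{Lip}_1(Y))$, where $\varphi,\psi$ run over all parameters of $X$ and $Y$, and $d_H$ is the Hausdorff distance with respect to $\operatorname{me}_{\mathcal{L}^1}$. A subset $\mathcal{P}\subset\mathcal{X}$ is a pyramid if (i) $X\in\mathcal{P}$ and $Y\prec X$ imply $Y\in\mathcal{P}$; (ii) for any $X,X'\in\mathcal{P}$ there is $Y\in\mathcal{P}$ with $X\prec Y$ and $X'\prec Y$; (iii) $\mathcal{P}$ is nonempty and $\square$-closed. The pyramid associated with $X$ is $\mathcal{P}_X:=\{X'\in\mathcal{X}\mid X'\prec X\}$. Pyramids $\mathcal{P}_n$ converge weakly to a pyramid $\mathcal{P}$ if $\lim_{n}\square(X,\mathcal{P}_n)=0$ for every $X\in\mathcal{P}$ and $\liminf_{n}\square(X,\mathcal{P}_n)>0$ for every $X\in\mathcal{X}\setminus\mathcal{P}$, where $\square(X,\mathcal{P}_n)=\inf_{Y\in\mathcal{P}_n}\square(X,Y)$. *)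

(* Defs.v *)
From HB Require Import structures.
From mathcomp Require Import all_boot all_order all_algebra.
From mathcomp Require Import all_classical all_reals all_analysis.

Set Implicit Arguments.
Unset Strict Implicit.
Unset Printing Implicit Defensive.

Import Order.TTheory GRing.Theory Num.Theory.
Import numFieldNormedType.Exports.

Local Open Scope classical_set_scope.
Local Open Scope ring_scope.

(* The base point is only there because g_sigma_algebraType asks for a
   pointedType; it plays no role in any notion below (and a space carrying a
   probability measure is nonempty anyway). *)
#[short(type="completePMetricType")]
HB.structure Definition CompletePMetric (R : realType) :=
  { T of Metric R T & Complete T & isPointed T }.

Definition borelType (T : ptopologicalType) := g_sigma_algebraType (@open T).

Definition separable (T : topologicalType) :=
  exists2 D : set T, countable D & dense D.

Definition msupp (R : realType) (T : ptopologicalType)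
    (mu : set (borelType T) -> \bar R) : set T :=
  [set x | forall U : set T, open U -> U x -> (0 < mu U)%E].

Record mmspace (R : realType) := MMSpace {
  mm_space :> completePMetricType R;
  mm_separable : separable mm_space;
  mm_measure : probability (borelType mm_space) R;
  mm_supp : msupp mm_measure = setT
}.

Section mm_notions.
Context {R : realType}.
Implicit Types X Y : mmspace R.

Definition lip1 (S T : metricType R) (f : S -> T) :=
  forall x y : S, mdist (f x) (f y) <= mdist x y.

(* f_* mu_X = mu_Y; f is 1-Lipschitz (resp. isometric) wherever this is used,
   hence Borel. *)
Definition push_eq X Y (f : X -> Y) :=
  forall A : set (borelType Y), measurable A ->
    mm_measure X (f @^-1` A) = mm_measure Y A.

Definition mm_iso X Y := exists f : X -> Y,
  [/\ forall x y : X, mdist (f x) (f y) = mdist x y,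
      forall y : Y, exists x, f x = y
    & push_eq f].

(* lip_le Y X is Y \prec X. *)
Definition lip_le Y X := exists f : X -> Y, lip1 f /\ push_eq f.

Definition I01 : set R := `[0, 1[%classic.

(* Parameters, and more generally functions on I = [0, 1), are represented by
   functions on R of which only the values on I01 matter. *)
Definition parameter X (phi : R -> X) :=
  measurable_fun I01 (phi : R -> borelType X) /\
  forall A : set (borelType X), measurable A ->
    lebesgue_measure (I01 `&` phi @^-1` A) = mm_measure X A.

(* Infima are taken in \bar R, where the infimum of the empty set is +oo. *)
Definition box X Y : \bar R :=
  ereal_inf [set e%:E | e in [set e : R | 0 <= e /\
    exists (phi : R -> X) (psi : R -> Y) (I0 : set R),
      [/\ parameter phi, parameter psi,
          measurable I0 /\ I0 `<=` I01,
          ((1 - e)%:E <= lebesgue_measure I0)%E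
        & forall s t, I0 s -> I0 t ->
            `|mdist (phi s) (phi t) - mdist (psi s) (psi t)| <= e]]].

Definition me (f g : R -> R) : \bar R :=
  ereal_inf [set e%:E | e in [set e : R | 0 <= e /\
    (lebesgue_measure [set s | I01 s /\ (e < `|f s - g s|)%R] <= e%:E)%E]].

Definition hausdorff_me (A B : set (R -> R)) : \bar R :=
  maxe (ereal_sup [set ereal_inf [set me f g | g in B] | f in A])
       (ereal_sup [set ereal_inf [set me f g | f in A] | g in B]).

Definition Lip1 X : set (X -> R) :=
  [set f | forall x y : X, `|f x - f y| <= mdist x y].
Arguments Lip1 X : clear implicits.

Definition pullback_Lip1 X (phi : R -> X) : set (R -> R) :=
  [set f \o phi | f in Lip1 X].

Definition dconc X Y : \bar R :=
  ereal_inf [set d | exists (phi : R -> X) (psi : R -> Y),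
    [/\ parameter phi, parameter psi
      & d = hausdorff_me (pullback_Lip1 phi) (pullback_Lip1 psi)]].

Definition box_to X (P : set (mmspace R)) : \bar R :=
  ereal_inf [set box X Y | Y in P].

Definition box_closed (P : set (mmspace R)) :=
  forall X, (forall e : R, 0 < e -> exists2 Y, P Y & (box X Y < e%:E)%E) -> P X.

(* A set of mm-isomorphism classes is represented by the union of these
   classes, i.e. by a set of mm-spaces saturated under mm_iso. *)
Definition pyramid (P : set (mmspace R)) :=
  [/\ forall X Y, mm_iso X Y -> P X -> P Y,
      forall X Y, P X -> lip_le Y X -> P Y,
      forall X X', P X -> P X' ->
        exists Y, [/\ P Y, lip_le X Y & lip_le X' Y],
      P !=set0
    & box_closed P].

Definition pyramid_of X : set (mmspace R) := [set X' | lip_le X' X].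

Definition weak_cvg (P_ : nat -> set (mmspace R)) (P : set (mmspace R)) :=
  (forall X, P X -> box_to X (P_ n) @[n --> \oo] --> 0%E) /\
  (forall X, ~ P X -> (0 < limn_einf (fun n => box_to X (P_ n)))%E).

End mm_notions.

(* Main.v *)
Require Import Defs.
From HB Require Import structures.
From mathcomp Require Import all_boot all_order all_algebra.
From mathcomp Require Import all_classical all_reals all_analysis.
From mathcomp Require Import measurable_realfun lra.

Set Implicit Arguments.
Unset Strict Implicit.
Unset Printing Implicit Defensive.

Import Order.TTheory GRing.Theory Num.Theory.
Import numFieldNormedType.Exports.

Local Open Scope classical_set_scope.
Local Open Scope ring_scope.

(** The common limit is the pyramid of all mm-spaces. Take for X_n and Y_n the
uniform measure on 2 (n + 1) points, with all mutual distances equal to n + 1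
in X_n and to n + 2 in Y_n. As atoms get small and distances get large, every
mm-space is almost dominated by both families ([box_uniform_space]), so both
sequences of associated pyramids converge weakly to the set of all mm-spaces;
this set is a pyramid, any two mm-spaces being dominated by their product
([prod_mmspace]).

The observable distance nevertheless stays at least 1/4
([dconc_simplex_ge]). Colour half of the points of Y_n with 0 and the other
half with n + 2: this is a 1-Lipschitz function, whereas every 1-Lipschitz
function on X_n oscillates by at most n + 1. If the two pulled back functions
differed by at most e < 1/4 outside a set of measure e, there would be good
parameter values in both halves, and the oscillations would differ by at most
2 e < 1/2.

To dominate a space close to a given mm-space X, fix a parameter phi of X, a
dense sequence u and a small e, and write c (s) for the index of a point u_i
within e / 3 of phi (s). By Lusin's theorem c is bounded and locally constant on a
compact set K of measure at least 1 - e, hence constant on the trace on K of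
each interval [i/N, (i+1)/N[ for N large ([nat_valued_almost_uniform]). The
N-point space with the distances of the corresponding points u_c, increased by
e / 3 off the diagonal so as to separate points, is a 1-Lipschitz image of the
N-point simplex as soon as the edges of the latter are long enough, and the
block map [0,1[ -> {0, ..., N-1} is a parameter of it which together with phi
and K bounds the box distance.

This needs a parameter of an arbitrary X ([parameter_exists]). It is obtained
from a Borel map h : X -> [0,1] having a Borel left inverse g : R -> X
([real_retraction]): if Q is the quantile function of the image of mu_X by h,
then g o Q is a parameter. *)

(** * The law of a map on the unit interval *)

Section law_of_map.
Context {R : realType}.

Lemma measurable_I01 : measurable (I01 : set R).
Proof. exact: measurable_itv. Qed.

Lemma lebesgue_I01 : lebesgue_measure (I01 : set R) = 1%E.
Proof.
by rewrite /I01 lebesgue_measure_itv/= lte_fin ltr01 -EFinB subr0.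
Qed.

Context d (T : measurableType d).

Definition law (f : R -> T) (mf : measurable_fun I01 f) (A : set T) : \bar R :=
  lebesgue_measure (I01 `&` f @^-1` A).

Variables (f : R -> T) (mf : measurable_fun I01 f).

Let law0 : law mf set0 = 0%E.
Proof. by rewrite /law preimage_set0 setI0 measure0. Qed.

Let law_ge0 A : (0 <= law mf A)%E.
Proof. exact: measure_ge0. Qed.

Let law_sigma_additive : semi_sigma_additive (law mf).
Proof.
move=> F mF tF mUF; rewrite /law preimage_bigcup setI_bigcupr.
apply: measure_semi_sigma_additive.
- by move=> n; apply: mf => //; exact: measurable_I01.
- apply/trivIsetP => /= i j _ _ ij; rewrite setIACA setIid -preimage_setI.
  by move/trivIsetP : tF => /(_ _ _ _ _ ij) ->//; rewrite preimage_set0 setI0.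
- rewrite -setI_bigcupr -preimage_bigcup; apply: mf => //.
  exact: measurable_I01.
Qed.

HB.instance Definition _ := isMeasure.Build _ _ _ (law mf)
  law0 law_ge0 law_sigma_additive.

Let law_setT : law mf setT = 1%E.
Proof. by rewrite /law preimage_setT setIT lebesgue_I01. Qed.

HB.instance Definition _ := Measure_isProbability.Build _ _ _ (law mf) law_setT.

End law_of_map.

(** * Quantile functions *)

Section quantile.
Context {R : realType} (nu : probability (measurableTypeR R) R).
Hypothesis nu01 : nu `[0, 1]%classic = 1%E.

Let F (t : R) : R := fine (nu `]-oo, t]%classic).

Let FE t : nu `]-oo, t]%classic = (F t)%:E.
Proof. by rewrite fineK// fin_num_measure. Qed.

Let nu_ray t : nu `]t, +oo[%classic = (1 - F t)%:E.
Proof.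
by rewrite EFinB -FE -probability_setC// setCitvl.
Qed.

Let F01 t : 0 <= F t <= 1.
Proof.
by rewrite -!lee_fin -FE measure_ge0/= probability_le1.
Qed.

Let F_nd s t : s <= t -> F s <= F t.
Proof.
move=> st; rewrite -lee_fin -!FE le_measure ?inE//.
by apply: subset_itvl; rewrite bnd_simp.
Qed.

Let F_neg t : t < 0 -> F t = 0.
Proof.
move=> t0; apply/eqP; rewrite eq_le (andP (F01 t)).1 andbT.
have : (nu `[0%R, 1%R]%classic <= nu `]t, +oo[%classic)%E.
  rewrite le_measure ?inE//; apply: subset_itv; rewrite bnd_simp//.
by rewrite nu01 nu_ray lee_fin; lra.
Qed.

Let F_ge1 t : 1 <= t -> F t = 1.
Proof.
move=> t1; apply/eqP; rewrite eq_le (andP (F01 t)).2/=.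
rewrite -lee_fin -FE -nu01 le_measure ?inE//.
by apply: subset_itv; rewrite bnd_simp.
Qed.

Let idR : measurableTypeR R -> R := idfun.

#[local] HB.instance Definition _ :=
  @isMeasurableFun.Build _ _ _ _ idR (@measurable_id _ _ setT).

Let F_right t s : F t < s -> exists2 u, t < u & F u <= s.
Proof.
move=> Fts.
have := @cdf_right_continuous _ _ _ nu (idR : {RV nu >-> R}) t.
rewrite /cdf /distribution /pushforward/= => cF.
have [|] := pselect (exists2 u, t < u & F u <= s) => // nex; exfalso.
have : (F t)%:E \in `[(s%:E), +oo[ => [|]; last first.
  by rewrite in_itv/= andbT lee_fin leNgt Fts.
rewrite in_itv/= andbT.
have -> : (F t)%:E = lim (cdf (idR : {RV nu >-> R}) x @[x --> t^'+]).
  by rewrite (cvg_lim _ cF)//= preimage_id FE.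
apply: lime_ge; first by apply/cvg_ex; eexists; exact: cF.
near=> u; rewrite /cdf /distribution /pushforward preimage_id FE lee_fin.
rewrite leNgt; apply/negP => /ltW Fus; apply: nex; exists u => //.
Unshelve. all: by end_near. Qed.

Let S s : set R := [set t | 0 <= t <= 1 /\ (t = 0 \/ F t <= s)].

Let S0 s : S s 0. Proof. by split; [rewrite lexx ler01|left]. Qed.

Let S_sup s : has_sup (S s).
Proof. by split; [exists 0|exists 1 => t [/andP[]]]. Qed.

(** Adjoining 0 to the set keeps it nonempty for every real s, so that the
quantile function is monotone, hence Borel, on the whole line; as nu lives on
[0,1], its values on ]0,1[ are those of the right-continuous quantile function
of nu. *)
Definition quantile (s : R) : R := sup (S s).

Let quantile_ge s t : S s t -> t <= quantile s.
Proof. by move=> St; apply: sup_upper_bound. Qed.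

Let quantile_nd : nondecreasing_fun quantile.
Proof.
move=> s t st; apply: sup_le_ub; first by exists 0.
move=> u [u01 H]; apply: quantile_ge; split => //.
by case: H => [->|H]; [left|right; exact: le_trans st].
Qed.

Lemma measurable_quantile : measurable_fun I01 quantile.
Proof. by apply: nondecreasing_measurable => //; exact: measurable_I01. Qed.

Let lt_quantile s t : 0 <= t -> t < quantile s -> F t <= s.
Proof.
move=> t0 /(sup_gt (ex_intro _ _ (S0 s)))[u [_ [->|Fus]] tu].
  by move: tu; rewrite ltNge t0.
by apply: le_trans Fus; apply/F_nd/ltW.
Qed.

Let quantile_gt s t : 0 <= t < 1 -> F t < s -> s < 1 -> t < quantile s.
Proof.
move=> /andP[t0 t1] Fts s1.
have [u tu Fus] := F_right Fts.
apply: (lt_le_trans tu); apply: quantile_ge; split; last by right.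
rewrite (le_trans t0 (ltW tu))/= leNgt; apply/negP => /ltW/F_ge1 Fu.
by move: Fus; rewrite Fu leNgt s1.
Qed.

(** For t in [0,1[, the event t < quantile s contains F t < s and is contained
in F t <= s; both have Lebesgue measure 1 - F t. *)
Let law_ray t :
  law measurable_quantile `]t, +oo[%classic = nu `]t, +oo[%classic.
Proof.
rewrite nu_ray.
have [t0|t0] := ltP t 0.
  rewrite F_neg// subr0 -(@lebesgue_I01 R) /law; congr (lebesgue_measure _).
  apply/setIidPl => s _ /=; rewrite in_itv/= andbT.
  by apply: (lt_le_trans t0); exact: quantile_ge.
have [t1|t1] := leP 1 t.
  rewrite F_ge1// subrr -[RHS](measure0 lebesgue_measure).
  congr (lebesgue_measure _); apply/seteqP; split => // s [_]/=.
  rewrite in_itv/= andbT ltNge => /negP; apply.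
  by apply: le_trans t1; apply: sup_le_ub => [|u [/andP[]]]; first by exists 0.
have mray : measurable (I01 `&` quantile @^-1` `]t, +oo[%classic).
  by apply: measurable_quantile => //; exact: measurable_I01.
have Ft := F01 t.
rewrite /law; apply/eqP; rewrite eq_le; apply/andP; split.
  have -> : (1 - F t)%:E = lebesgue_measure (`[F t, 1[%classic : set R).
    rewrite lebesgue_measure_itv/= lte_fin.
    by case: ltP => // ?; congr EFin; lra.
  rewrite le_measure ?inE//.
  move=> s []; rewrite /I01/= !in_itv/= andbT => /andP[s0 s1] ts.
  by rewrite s1 lt_quantile.
have -> : (1 - F t)%:E = lebesgue_measure (`]F t, 1[%classic : set R).
  rewrite lebesgue_measure_itv/= lte_fin.
    by case: ltP => // ?; congr EFin; lra.
rewrite le_measure ?inE// => s; rewrite /I01/= !in_itv/= andbT => /andP[Fs s1].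
by rewrite s1 quantile_gt ?t0// andbT; split => //; lra.
Qed.

Lemma law_quantile (A : set R) : measurable A ->
  lebesgue_measure (I01 `&` quantile @^-1` A) = nu A.
Proof.
move=> mA; rewrite -[LHS]/(law measurable_quantile A).
apply: (@measure_unique _ R (measurableTypeR R) (@RGenOInfty.G R)
  (fun n : nat => `](- n%:R), +oo[%classic) _ _ _ _
  (law (T := measurableTypeR R) measurable_quantile) nu) => //.
- exact: RGenOInfty.measurableE.
- move=> _ _ [x ->] [y ->]; exists (Num.max x y).
  by apply/seteqP; split => z /=; rewrite !in_itv/= !andbT gt_max => /andP.
- by move=> n; exists (- n%:R).
- apply/seteqP; split => // x _; exists (Num.truncn `|x|).+1 => //=.
  rewrite in_itv/= andbT ltrNl; apply: (le_lt_trans (ler_norm _)).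
  by rewrite normrN truncnS_gt.
- by move=> _ [x ->]; exact: law_ray.
- by move=> n; rewrite -ge0_fin_numE// fin_num_measure.
Qed.

End quantile.

(** * Coding a sequence of events into a real number *)

(** A sequence of events U_k is recorded in the Cantor set, by the number whose
k-th ternary digit is 2 on U_k and 0 elsewhere. The digit 1 never occurs, so
that the first digit of a tail of the expansion is read by comparing it with
2/3, and decoding is a Borel operation on the whole real line. *)
Section ternary_coding.
Context {R : realType} d (T : measurableType d) (U : nat -> set T).
Hypothesis mU : forall k, measurable (U k).

(** The n-digit truncation of the expansion read from the k-th digit on. *)
Fixpoint ternary (n k : nat) (x : T) : R :=
  if n is n'.+1 then (2 * \1_(U k) x + ternary n' k.+1 x) / 3 else 0.

Let indic01 k x : 0 <= (\1_(U k) x : R) <= 1.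
Proof. by rewrite indicE ler0n lern1 leq_b1. Qed.

Let ternary01 n k x : 0 <= ternary n k x <= 1.
Proof.
elim: n k => [|n IH] k /=; first by rewrite lexx ler01.
have := IH k.+1; have := indic01 k x; lra.
Qed.

Let ternary_nd k x : nondecreasing_seq (fun n => ternary n k x).
Proof.
apply/nondecreasing_seqP => n; elim: n k => [|n IH] k.
  by rewrite [leLHS]/=; have /andP[] := ternary01 1 k x.
by rewrite /=; have := IH k.+1 => /=; lra.
Qed.

Let tail k x : R := lim (ternary n k x @[n --> \oo]).

Let cvg_tail k x : ternary n k x @[n --> \oo] --> tail k x.
Proof.
apply: nondecreasing_is_cvgn; first exact: ternary_nd.
by exists 1 => _ [n _ <-]; have /andP[] := ternary01 n k x.
Qed.

Let tailS k x : tail k x = (2 * \1_(U k) x + tail k.+1 x) / 3.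
Proof.
apply: cvg_lim => //; rewrite -(@cvg_shiftn 1).
under eq_fun do rewrite addn1 /=.
apply: cvgMl; apply: cvgD; [exact: cvg_cst|exact: cvg_tail].
Qed.

Let tail01 k x : 0 <= tail k x <= 1.
Proof.
have cv := cvgP _ (@cvg_tail k x); apply/andP; split.
  by apply: limr_ge => //; near=> n; have /andP[] := ternary01 n k x.
by apply: limr_le => //; near=> n; have /andP[] := ternary01 n k x.
Unshelve. all: by end_near. Qed.

Let digit_tail k x : (2 / 3 <= tail k x) = (x \in U k).
Proof.
have := tail01 k.+1 x; rewrite (tailS k) indicE.
by case: (x \in U k) => /= H; apply/idP/idP => //; lra.
Qed.

Let shift (t : R) : R := 3 * t - 2 * \1_(`[2 / 3, +oo[%classic) t.

Let shift_tail k x : shift (tail k x) = tail k.+1 x.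
Proof.
rewrite /shift indicE mem_setE in_itv/= andbT digit_tail.
by rewrite [X in 3 * X]tailS indicE; lra.
Qed.

Let iter_shift_tail k x : iter k shift (tail 0 x) = tail k x.
Proof. by elim: k => //= k ->; rewrite shift_tail. Qed.

Let measurable_iter_shift k : measurable_fun setT (iter k shift).
Proof.
elim: k => [|k IH] /=; first exact: measurable_id.
have mshift : measurable_fun setT shift.
  by apply: measurable_funB; apply: measurable_funM.
exact: measurableT_comp mshift IH.
Qed.

Let measurable_tail k : measurable_fun setT (tail k).
Proof.
apply: (@measurable_fun_cvg _ _ _ _ (fun n => ternary n k)).
  move=> n; elim: n k => [|n IH] k /=; first exact: measurable_cst.
  apply: measurable_funM => //; apply: measurable_funD => //.
  by apply: measurable_funM => //; exact: measurable_indic.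
by move=> x _; exact: cvg_tail.
Qed.

Lemma real_coding : exists (h : T -> R) (V : nat -> set R),
  [/\ measurable_fun setT h, forall x, 0 <= h x <= 1,
      forall k, measurable (V k) & forall k, h @^-1` V k = U k].
Proof.
exists (tail 0), (fun k => iter k shift @^-1` `[2 / 3, +oo[%classic).
split => [|x|k|k]; [exact: measurable_tail|exact: tail01| |].
  by rewrite -[X in measurable X]setTI; apply: measurable_iter_shift.
apply/seteqP; split => x /=; rewrite in_itv/= andbT iter_shift_tail digit_tail.
  exact: set_mem.
exact: mem_set.
Qed.

End ternary_coding.

(** * Borel quantizations of a separable metric space *)

Section first_hit.
Context {T : Type} (F : nat -> set T).

Definition first_hit (t : T) : nat := xget 0%N [set i | seqDU F i t].

Lemma first_hitP t i : seqDU F i t -> first_hit t = i.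
Proof.
move=> Fit; have Fht : seqDU F (first_hit t) t.
  by apply: (@xgetPex _ 0%N [set j | seqDU F j t]); exists i.
apply: (@trivIset_seqDU _ F) => //; first by exists t.
Qed.

Lemma first_hitE t : (\bigcup_i F i) t -> seqDU F (first_hit t) t.
Proof.
by rewrite seqDU_bigcup_eq => -[i _ Fit]; rewrite (first_hitP Fit).
Qed.

Lemma first_hit_preimage i : (\bigcup_i F i = setT) ->
  first_hit @^-1` [set i] = seqDU F i.
Proof.
move=> FT; apply/seteqP; split => t /=; last exact: first_hitP.
by move=> <-; apply: first_hitE; rewrite FT.
Qed.

End first_hit.

Section borel_coding.
Context {R : realType} (T : completePMetricType R).

Lemma open_borel (A : set T) : open A -> measurable (A : set (borelType T)).
Proof. by move=> oA; exact: sub_sigma_algebra. Qed.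

Lemma measurable_fun_borel d (S : measurableType d) (D : set S) (f : S -> T) :
  (forall A, open A -> measurable (D `&` f @^-1` A)) ->
  measurable_fun D (f : S -> borelType T).
Proof.
move=> mf; apply: (@measurability _ _ _ (borelType T) D f (@open T)) => //.
by move=> _ [A oA <-]; exact: mf.
Qed.

Lemma open_mball (x : T) (e : R) : open (ball x e).
Proof.
rewrite openE => y; rewrite ballEmdist /= => xye.
have d0 : 0 < e - mdist x y by rewrite subr_gt0.
apply/nbhs_ballP; exists (e - mdist x y) => //= z.
rewrite !ballEmdist/= => yz; apply: le_lt_trans (metric_triangle _ y _) _.
by rewrite -ltrBrDl.
Qed.

Lemma measurable_ball_borel (x : T) (e : R) :
  measurable (ball x e : set (borelType T)).
Proof. by apply: open_borel; exact: open_mball. Qed.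

Hypothesis sepT : separable T.

Lemma dense_sequence :
  exists u : nat -> T, forall (y : T) (e : R), 0 < e ->
    exists i, mdist (u i) y < e.
Proof.
have [D cD dD] := sepT.
have /pcard_surjP[u uD] := cD.
exists u => y e e0.
have [|z [yz Dz]] := dD (ball y e) _ (@open_mball y e).
  by exists y; exact: ballxx.
have [i _ uz] := uD _ Dz; exists i; rewrite uz.
by move: yz; rewrite ballEmdist /= metric_sym.
Qed.

(** Sending y to the first i such that y is within e of u_i makes the fibres
differences of finite unions of balls. *)
Lemma borel_quantization (u : nat -> T) (e : R) :
  (forall y, exists i, mdist (u i) y < e) ->
  exists c : T -> nat,
    (forall i, measurable (c @^-1` [set i] : set (borelType T))) /\
    forall y, mdist (u (c y)) y < e.
Proof.
move=> ue; pose B i : set T := ball (u i) e.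
have BT : \bigcup_i B i = setT.
  apply/seteqP; split => // y _; have [i uiy] := ue y.
  by exists i => //; rewrite /B ballEmdist.
exists (first_hit B); split => [i|y].
  rewrite first_hit_preimage//; apply: seqDU_measurable => j.
  exact: measurable_ball_borel.
have : B (first_hit B y) y.
  by apply: subset_seqDU; apply: first_hitE; rewrite BT.
by rewrite /B ballEmdist.
Qed.

End borel_coding.

(** * Complete separable metric spaces as Borel retracts of the line *)

Lemma exp2V_lt {R : realType} (e : R) : 0 < e -> exists m : nat, 2 ^- m < e.
Proof.
move=> e0; exists (Num.truncn e^-1).+1.
rewrite invf_plt ?posrE ?exprn_gt0//.
apply: (lt_trans (truncnS_gt _)); rewrite -natrX ltr_nat.
exact: ltn_expl.
Qed.

(** The steps from the m-th term on sum to at most 4 / 2^m. *)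
Section geometric_cauchy.
Context {R : realType} (T : completePMetricType R) (v : nat -> T).
Hypothesis v_step : forall m, mdist (v m) (v m.+1) <= 2 * 2 ^- m.

Let dist_add m k : mdist (v m) (v (m + k)%N) <= 4 * 2 ^- m - 4 * 2 ^- (m + k).
Proof.
elim: k => [|k IH]; first by rewrite addn0 mdistxx subrr.
rewrite addnS; apply: le_trans (metric_triangle _ (v (m + k)%N) _) _.
have := v_step (m + k); rewrite (exprS _ (m + k)) invfM.
move: (2 ^- (m + k)) IH => a; lra.
Qed.

Let dist_le m n : (m <= n)%N -> mdist (v m) (v n) <= 4 * 2 ^- m.
Proof.
move=> mn; rewrite -(subnKC mn); apply: le_trans (dist_add _ _) _.
by rewrite lerBlDr lerDl mulr_ge0.
Qed.

Lemma geometric_is_cvg : cvgn v.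
Proof.
apply: cauchy_cvg; apply: cauchy_exP => e e0.
have [m mE] : exists m : nat, 2 ^- m < e / 4.
  by apply: exp2V_lt; rewrite divr_gt0.
exists (v m); suff : \forall n \near \oo, ball (v m) e (v n) by [].
near=> n; rewrite ballEmdist/=.
apply: (@le_lt_trans _ _ (4 * 2 ^- m)); last by lra.
by apply: dist_le; near: n; exact: nbhs_infty_ge.
Unshelve. all: by end_near. Qed.

Lemma geometric_dist_lim m : mdist (v m) (limn v) <= 4 * 2 ^- m.
Proof.
apply/ler_addgt0Pl => e e0; rewrite addrC.
have /metricType_numDomainType.cvgrPdist_lt/(_ _ e0) H := geometric_is_cvg.
near \oo => n; apply: le_trans (metric_triangle _ (v n) _) _.
apply: lerD.
  by apply: dist_le; near: n; exact: nbhs_infty_ge.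
by rewrite metric_sym ltW//; near: n.
Unshelve. all: by end_near. Qed.

End geometric_cauchy.

Section polish_retraction.
Context {R : realType} (T : completePMetricType R).
Hypothesis sepT : separable T.

(** The number h (y) encodes the indices c_m (y) of points of a dense sequence
at distance less than 2^-m from y, for all m. Decoding a real t gives a
sequence of points; where it is well defined and has steps at most 2 / 2^m, a
Borel condition on t, the map g takes its limit. For t = h (y) that limit is y
itself. Decoding every real in this way avoids the delicate question whether
the range of h is Borel. *)
Lemma real_retraction : exists (h : T -> R) (g : R -> T),
  [/\ measurable_fun setT (h : borelType T -> R), forall y, 0 <= h y <= 1,
      measurable_fun setT (g : R -> borelType T) & cancel h g].
Proof.
have [u uP] := dense_sequence sepT.
have /choice[c cP] : forall m : nat, exists c : T -> nat,
    (forall i, measurable (c @^-1` [set i] : set (borelType T))) /\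
    forall y, mdist (u (c y)) y < 2 ^- m.
  by move=> m; apply: borel_quantization => y; apply: uP.
pose U k : set (borelType T) :=
  if unpickle k is Some mi then c mi.1 @^-1` [set mi.2] else set0.
have mU k : measurable (U k).
  by rewrite /U; case: unpickle => [mi|//]; exact: (cP mi.1).1.
have [h [V [mh h01 mV hV]]] := @real_coding R _ _ _ mU.
pose W (m i : nat) : set R := V (pickle (m, i)).
have hW m i y : W m i (h y) <-> c m y = i.
  by rewrite -[W m i (h y)]/((h @^-1` W m i) y) hV /U pickleK.
(* C m i: the m-th decoded index is i. For an arbitrary t several W m i may
   hold; the first one is retained. *)
pose C m i : set R := seqDU (W m) i.
have mC m i : measurable (C m i) by apply: seqDU_measurable => j; exact: mV.
have hC m y : C m (c m y) (h y).
  split; first exact/hW.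
  rewrite -bigcup_mkord => -[j /= jc /hW cj].
  by rewrite cj ltnn in jc.
pose D m t : nat := first_hit (W m) t.
have DC m i t : C m i t -> D m t = i by exact: first_hitP.
(* The m-th and next indices are defined and close enough to each other. *)
pose E m : set R := \bigcup_i
  \bigcup_(j in [set j | mdist (u i) (u j) <= 2 * 2 ^- m]) (C m i `&` C m.+1 j).
have mE : measurable (\bigcap_m E m).
  apply: bigcapT_measurable => m; apply: bigcupT_measurable => i.
  by apply: bigcup_measurable => j _; exact: measurableI.
have E_step t : (\bigcap_m E m) t ->
    forall m, mdist (u (D m t)) (u (D m.+1 t)) <= 2 * 2 ^- m.
  by move=> Et m; have [i _ [j /= ij [/DC -> /DC ->]]] := Et m I.
have E_C t : (\bigcap_m E m) t -> forall m, C m (D m t) t.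
  by move=> Et m; have [i _ [j /= ij [+ _]]] := Et m I => /[dup]/DC ->.
have hE y : (\bigcap_m E m) (h y).
  move=> m _; exists (c m y) => //; exists (c m.+1 y) => //=.
  apply: le_trans (metric_triangle _ y _) _; rewrite (metric_sym y).
  have := (cP m).2 y; have := (cP m.+1).2 y; rewrite exprS invfM.
  have : 0 < 2 ^- m :> R by rewrite invr_gt0 exprn_gt0.
  by move: (2 ^- m) => a; lra.
pose g t : T :=
  if t \in \bigcap_m E m then limn (fun m => u (D m t)) else point.
have g_dist t : (\bigcap_m E m) t ->
    forall m, mdist (u (D m t)) (g t) <= 4 * 2 ^- m.
  move=> Et m; rewrite /g mem_set//.
  exact: (@geometric_dist_lim _ _ (fun m => u (D m t)) (E_step t Et) m).
exists h, g; split => // [|y]; last first.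
  apply: mdist_positivity; apply/eqP; rewrite eq_le mdist_ge0 andbT leNgt.
  apply/negP => d0.
  have [m] : exists m : nat, 2 ^- m < mdist (g (h y)) y / 5.
    by apply: exp2V_lt; rewrite divr_gt0.
  have := g_dist _ (hE y) m; rewrite (DC _ _ _ (hC m y)) => d1.
  have := (cP m).2 y; have := metric_triangle (g (h y)) (u (c m y)) y.
  rewrite (metric_sym (g _) (u _)).
  by move: (2 ^- m) d1 => a; lra.
(* On the domain of convergence g t lies in the open set O iff some ball
   around a decoded point contains g t and is contained in O; the radius
   5 / 2^m exceeds the error bound 4 / 2^m. *)
apply: measurable_fun_borel => O oO; rewrite setTI.
have -> : g @^-1` O = (\bigcap_m E m `&` \bigcup_m
    \bigcup_(i in [set i | ball (u i) (5 * 2 ^- m) `<=` O]) C m i)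
    `|` (~` (\bigcap_m E m) `&` [set _ | O point]).
  apply/seteqP; split => t /=.
    have [Et Ogt|nEt] := pselect ((\bigcap_m E m) t); last first.
      by rewrite /g memNset// => Op; right.
    left; split => //.
    have /nbhs_ballP[e /= e0 eO] : nbhs (g t) O by apply: open_nbhs_nbhs.
    have [m mlt] : exists m : nat, 2 ^- m < e / 9.
      by apply: exp2V_lt; rewrite divr_gt0.
    exists m => //; exists (D m t); last exact: E_C.
    move=> z; rewrite ballEmdist/= => uz; apply: eO; rewrite ballEmdist/=.
    apply: le_lt_trans (metric_triangle _ (u (D m t)) _) _.
    rewrite metric_sym; have := g_dist _ Et m.
    by move: (2 ^- m) uz mlt => a; lra.
  move=> [[Et [m _ [i /= iO /DC Di]]]|[nEt Op]]; last by rewrite /g memNset.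
  apply: iO; rewrite ballEmdist/= -Di.
  apply: le_lt_trans (g_dist _ Et m) _.
  have : 0 < 2 ^- m :> R by rewrite invr_gt0 exprn_gt0.
  by move: (2 ^- m) => a; lra.
apply: measurableU; apply: measurableI => //.
- apply: bigcupT_measurable => m; apply: bigcup_measurable => i _; exact: mC.
- exact: measurableC.
- have [Op|nOp] := pselect (O point).
    by rewrite (_ : [set _ | _] = setT)//; apply/seteqP; split.
  by rewrite (_ : [set _ | _] = set0)//; apply/seteqP; split.
Qed.

End polish_retraction.

(** As g is a left inverse of h, transporting mu_X by h and then by g gives
mu_X back; replacing the first transport by the quantile function makes it start
from Lebesgue measure. *)
Lemma parameter_exists {R : realType} (X : mmspace R) :
  exists phi : R -> X, parameter phi.
Proof.
have [h [g [mh h01 mg hK]]] := real_retraction (@mm_separable _ X).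
pose H : {mfun borelType X >-> measurableTypeR R} :=
  HB.pack (h : borelType X -> measurableTypeR R)
    (isMeasurableFun.Build _ _ _ _ (h : borelType X -> measurableTypeR R) mh).
pose nu : probability (measurableTypeR R) R := distribution (mm_measure X) H.
have nu01 : nu `[0, 1]%classic = 1%E.
  rewrite -(probability_setT (mm_measure X)) /nu /distribution /pushforward/=.
  congr (mm_measure X _); apply/seteqP; split => // x _ /=.
  by rewrite in_itv/= h01.
exists (g \o quantile nu); split.
  by apply: measurableT_comp mg _; exact: measurable_quantile.
move=> A mA; rewrite comp_preimage law_quantile//.
  rewrite /nu /distribution /pushforward/= -comp_preimage.
  by congr (mm_measure X _); apply/seteqP; split => x /=; rewrite hK.
by rewrite -[X in measurable X]setTI; exact: mg.
Qed.

(** * Finite metric spaces with the uniform measure *)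

Section block.
Context {R : realType} (n : nat).

Definition block (s : R) : 'I_n.+1 := inord (Num.truncn (s * n.+1%:R)).

Lemma block_itv (i : 'I_n.+1) :
  I01 `&` block @^-1` [set i] =
  `[i%:R / n.+1%:R, i.+1%:R / n.+1%:R[%classic.
Proof.
apply/seteqP; split => s; rewrite /I01 /= !in_itv/=.
  move=> [/andP[s0 s1] <-]; rewrite /block inordK; last first.
    rewrite -(ltr_nat R); apply: (@le_lt_trans _ _ (s * n.+1%:R)).
      by rewrite truncn_le mulr_ge0.
    by rewrite gtr_pMl.
  rewrite ler_pdivrMr// ltr_pdivlMr// truncnS_gt andbT.
  by rewrite truncn_le mulr_ge0.
rewrite ler_pdivrMr// ltr_pdivlMr// => /andP[is_ si]; split.
  apply/andP; split.
    by rewrite -(@pmulr_lge0 _ n.+1%:R)// (le_trans _ is_).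
  rewrite -(@ltr_pM2r _ n.+1%:R)// mul1r (lt_le_trans si)// ler_nat.
  exact: ltn_ord.
apply/val_inj; rewrite /block /= inordK; last first.
  rewrite -(ltr_nat R); apply: (@le_lt_trans _ _ (s * n.+1%:R)).
    by rewrite truncn_le (le_trans _ is_).
  by rewrite (lt_le_trans si)// ler_nat.
by apply/truncn_def; rewrite is_ si.
Qed.

Lemma measurable_block d (T : measurableType d) (f : 'I_n.+1 -> T) :
  measurable_fun I01 (f \o block).
Proof.
move=> _ A _; have -> : I01 `&` (f \o block) @^-1` A =
    \bigcup_(i in f @^-1` A) (I01 `&` block @^-1` [set i]).
  apply/seteqP; split => s /=; first by move=> [sI As]; exists (block s).
  by move=> [i Ai [sI] /= si]; split => //; rewrite /= si.
apply: fin_bigcup_measurable; first exact: finite_finset.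
by move=> i _; rewrite block_itv; exact: measurable_itv.
Qed.

Lemma lebesgue_block (i : 'I_n.+1) :
  lebesgue_measure (I01 `&` block @^-1` [set i]) = (n.+1%:R^-1)%:E.
Proof.
rewrite block_itv lebesgue_measure_itv/= lte_fin ltr_pM2r// ltr_nat ltnSn.
by rewrite -EFinB -mulrBl -natrB// subSnn mul1r.
Qed.

Lemma block_close (s t : R) : I01 s -> I01 t -> block s = block t ->
  `|s - t| < n.+1%:R^-1.
Proof.
move=> sI tI st.
have : (I01 `&` block @^-1` [set block t]) s by [].
have : (I01 `&` block @^-1` [set block t]) t by [].
rewrite block_itv /= !in_itv/= -[(block t).+1%:R]natr1 mulrDl mul1r.
by move: (_ / _) => a; move: (_^-1) => b; rewrite ltr_norml; lra.
Qed.

End block.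

Record fin_dist (R : realType) (n : nat) := FinDist {
  fdist :> 'I_n.+1 -> 'I_n.+1 -> R;
  fdistxx : forall i, fdist i i = 0;
  fdist_positivity : forall i j, fdist i j = 0 -> i = j;
  fdist_sym : forall i j, fdist i j = fdist j i;
  fdist_triangle : forall j i k, fdist i k <= fdist i j + fdist j k }.

(** The points are taken in a subtype of [nat] rather than in the type of
ordinals, so that the carrier lies in a universe small enough for an
mm-space. *)
Definition fin_space (R : realType) (n : nat) (d : fin_dist R n) : Set :=
  {i : nat | (i < n.+1)%N}.

Section fin_space_index.
Context {R : realType} {n : nat} (d : fin_dist R n).

Definition fin_index (x : fin_space d) : 'I_n.+1 := Ordinal (svalP x).
Definition fin_point (i : 'I_n.+1) : fin_space d :=
  exist _ (val i) (ltn_ord i).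

Lemma fin_pointK : cancel fin_point fin_index.
Proof. by move=> i; exact: val_inj. Qed.

Lemma fin_indexK : cancel fin_index fin_point.
Proof. by move=> x; exact: val_inj. Qed.

Definition fin_mdist (x y : fin_space d) : R := d (fin_index x) (fin_index y).

Lemma fin_mdistxx x : fin_mdist x x = 0.
Proof. exact: fdistxx. Qed.

Lemma fin_mdist_positivity x y : fin_mdist x y = 0 -> x = y.
Proof. by move=> /fdist_positivity/(can_inj fin_indexK). Qed.

Lemma fin_mdist_sym x y : fin_mdist x y = fin_mdist y x.
Proof. exact: fdist_sym. Qed.

Lemma fin_mdist_triangle y x z : fin_mdist x z <= fin_mdist x y + fin_mdist y z.
Proof. exact: fdist_triangle. Qed.

End fin_space_index.

HB.instance Definition _ R n (d : fin_dist R n) := Choice.on (fin_space d).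
HB.instance Definition _ R n (d : fin_dist R n) :=
  isPointed.Build (fin_space d) (fin_point d ord0).
HB.instance Definition _ (R : realType) n (d : fin_dist R n) :=
  isMetric.Build R (fin_space d) (@fin_mdistxx _ _ d)
    (@fin_mdist_positivity _ _ d) (@fin_mdist_sym _ _ d)
    (@fin_mdist_triangle _ _ d).

Lemma fin_mdistE (R : realType) n (d : fin_dist R n) (x y : fin_space d) :
  mdist x y = d (fin_index x) (fin_index y).
Proof. by []. Qed.

Lemma fin_space_finite {R : realType} {n : nat} (d : fin_dist R n)
  (A : set (fin_space d)) : finite_set A.
Proof.
apply: (sub_finite_set (B := range (@fin_point _ _ d))).
  by move=> x _; exists (fin_index x) => //; exact: fin_indexK.
by apply: finite_image; exact: (@finite_finset 'I_n.+1).
Qed.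

Lemma fin_space_complete {R : realType} {n : nat} (d : fin_dist R n)
  (F : set_system (fin_space d)) : ProperFilter F -> cauchy F -> cvg F.
Proof.
move=> PF cF; apply: (compact_cauchy_cvg _ cF filterT).
exact/finite_compact/fin_space_finite.
Qed.

HB.instance Definition _ (R : realType) n (d : fin_dist R n) :=
  Uniform_isComplete.Build (fin_space d) (@fin_space_complete _ _ d).

Section fin_space.
Context {R : realType} {n : nat} (d : fin_dist R n).

Definition fin_block (s : R) : borelType (fin_space d) :=
  fin_point d (block n s).

Lemma measurable_fin_block : measurable_fun I01 fin_block.
Proof.
exact: (measurable_block (fin_point d : _ -> borelType (fin_space d))).
Qed.

(** Defining the uniform measure as an image of Lebesgue measure makes the block
map a parameter by construction. *)
Definition uniform_law : probability (borelType (fin_space d)) R :=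
  law measurable_fin_block.

Lemma fin_space_separable : separable (fin_space d).
Proof.
exists setT; first by apply: finite_set_countable; exact: fin_space_finite.
by move=> U [x Ux] _; exists x.
Qed.

Lemma measurable_fin_space (A : set (borelType (fin_space d))) : measurable A.
Proof.
have cA : closed (~` A : set (fin_space d)).
  have /accessible_finite_set_closed : accessible_space (fin_space d).
    exact/hausdorff_accessible/metric_hausdorff.
  by apply; exact: fin_space_finite.
have oA : open (A : set (fin_space d)) by rewrite -[A]setCK openC.
exact: (open_borel oA).
Qed.

Lemma uniform_law_supp : msupp uniform_law = setT.
Proof.
apply/seteqP; split => // x _ U oU Ux.
apply: (@lt_le_trans _ _ (n.+1%:R^-1)%:E); first by rewrite lte_fin.
rewrite -(@lebesgue_block R _ (fin_index x)).
apply: le_measure; rewrite ?inE.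
- by rewrite block_itv; exact: measurable_itv.
- apply: measurable_fin_block; first exact: measurable_I01.
  exact: (open_borel oU).
- by apply: setIS => s /= sx; rewrite /fin_block sx fin_indexK.
Qed.

Definition uniform_space : mmspace R :=
  MMSpace fin_space_separable uniform_law_supp.

Lemma parameter_fin_block : parameter (fin_block : R -> uniform_space).
Proof. by split=> //; exact: measurable_fin_block. Qed.

End fin_space.

(** * Approximation of mm-spaces by finite spaces *)

(** By Lusin's theorem c is continuous on a compact set K of almost full
measure. Being integer-valued it is locally constant there, and compactness
turns this into a uniform radius and a bound. *)
Lemma nat_valued_almost_uniform {R : realType} (c : R -> nat) (e : R) :
  0 < e -> (forall i, measurable (I01 `&` c @^-1` [set i])) ->
  exists (N : nat) (delta : R) (K : set R),
    [/\ 0 < delta, measurable K, K `<=` I01,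
        ((1 - e)%:E <= lebesgue_measure K)%E
      & (forall s, K s -> (c s <= N)%N) /\
        forall s t, K s -> K t -> `|s - t| < delta -> c s = c t].
Proof.
move=> e0 mc; pose f s : R := (c s)%:R.
have mf : measurable_fun I01 f.
  move=> _ A mA; have -> : I01 `&` f @^-1` A =
      \bigcup_(i in [set i | A i%:R]) (I01 `&` c @^-1` [set i]).
    apply/seteqP; split => s /=; first by move=> [sI As]; exists (c s).
    by move=> [i Ai [sI /= si]]; split => //; rewrite /= /f si.
  by apply: bigcup_measurable => i _; exact: mc.
have I_fin : (lebesgue_measure (I01 : set R) < +oo)%E.
  by rewrite lebesgue_I01 ltry.
have [K [cK KI KIe fK]] :=
  measurable_almost_continuous measurable_I01 I_fin e0 mf.
have mK : measurable K.
  by apply: closed_measurable; apply: compact_closed => //; exact: Rhausdorff.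
have locK x : K x -> exists2 r, 0 < r &
    forall y, K y -> `|x - y| < r -> c y = c x.
  move=> Kx; move/subspace_continuousP : (fK) => /(_ x Kx).
  move=> /cvgrPdist_lt/(_ 1 ltr01); rewrite near_withinE.
  move=> /nbhs_ballP[r r0 xr].
  exists r => // y Ky xy; have := xr y xy Ky.
  rewrite /f/= ltr_norml.
  have lt_nat (m n : nat) : (m < n)%N -> m%:R + 1 <= n%:R :> R.
    by move=> mn; rewrite natr1 ler_nat.
  by case: (ltngtP (c y) (c x)) => // /lt_nat ? ?; exfalso; lra.
have nK := (near_covering_withinP K).2 ((compact_near_coveringP K).1 cK).
have [N _ NK] : \forall N \near \oo, K `<=` [set s | (c s <= N)%N].
  apply: nK => x Kx; have [r r0 xr] := locK x Kx.
  exists (ball x r, [set N | (c x <= N)%N]) => /=.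
    by split; [exact: nbhsx_ballx|exact: nbhs_infty_ge].
  by move=> [y N] /= [xy cN] Ky; rewrite (xr y).
have [d /= d0 dK] : \forall d \near 0^'+,
    K `<=` [set s | forall t, K t -> `|s - t| < d -> c s = c t].
  apply: nK => x Kx; have [r r0 xr] := locK x Kx.
  exists (ball x (r / 2), [set d | d < r / 2]) => /=.
    by split; [apply: nbhsx_ballx|apply: nbhs_right_lt]; rewrite divr_gt0.
  move=> [y d] /= [xy dr] Ky t Kt yt; rewrite (xr y)// ?(xr t)//.
    rewrite (splitr r); apply: le_lt_trans (ler_distD y _ _) _.
    by rewrite ltrD// (lt_trans yt).
  by rewrite (lt_le_trans xy)// ler_pdivrMr// ler_pMr// ler1n.
exists N, (d / 2), K; split => //; first by rewrite divr_gt0.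
  rewrite EFinB leeBlDr// -(@lebesgue_I01 R).
  rewrite -[X in lebesgue_measure X](setDUK KI).
  apply: (@le_trans _ _ (lebesgue_measure K + lebesgue_measure (I01 `\` K))%E).
    by apply: measureU2 => //; apply: measurableD => //; exact: measurable_I01.
  by rewrite leeD2l// ltW.
split=> [s Ks|s t Ks Kt st]; first by apply: (NK N) => /=.
apply: (dK (d / 2)) => //=; rewrite ?divr_gt0//.
by rewrite sub0r normrN gtr0_norm ?divr_gt0// ltr_pdivrMr// ltr_pMr// ltr1n.
Qed.

(** The identity of the index set is 1-Lipschitz, and it preserves the measure
because the two spaces have the same block map. *)
Lemma uniform_space_lip_le {R : realType} n (d d' : fin_dist R n) :
  (forall i j, d' i j <= d i j) ->
  lip_le (uniform_space d') (uniform_space d).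
Proof.
move=> dd'; exists (fun x : fin_space d => fin_point d' (fin_index x)); split.
  by move=> x y; rewrite !fin_mdistE !fin_pointK; exact: dd'.
move=> A mA; rewrite /= /uniform_law /= /law.
congr (lebesgue_measure (I01 `&` _)).
by apply/seteqP; split => s /=; rewrite /fin_block fin_pointK.
Qed.

(** The points p_i may coincide; adding eta off the diagonal makes a genuine
distance on the index set, without having to select distinct points and to
recompute their masses. *)
Section perturbed_dist.
Context {R : realType} (T : metricType R) (n : nat).
Variables (p : 'I_n.+1 -> T) (eta : R).
Hypothesis eta0 : 0 < eta.

Definition perturbed (i j : 'I_n.+1) : R :=
  mdist (p i) (p j) + (if i == j then 0 else eta).

Let perturbedxx i : perturbed i i = 0.
Proof. by rewrite /perturbed eqxx mdistxx addr0. Qed.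

Let perturbed_positivity i j : perturbed i j = 0 -> i = j.
Proof.
rewrite /perturbed; case: eqVneq => // _ /eqP.
by rewrite gt_eqF// ltr_wpDl ?mdist_ge0.
Qed.

Let perturbed_sym i j : perturbed i j = perturbed j i.
Proof. by rewrite /perturbed metric_sym eq_sym. Qed.

Let perturbed_triangle j i k : perturbed i k <= perturbed i j + perturbed j k.
Proof.
rewrite /perturbed addrACA lerD ?metric_triangle//.
have [<-|ij] := eqVneq i j; first by rewrite add0r.
have [<-|_] := eqVneq j k; first by rewrite (negPf ij); have := eta0; lra.
by case: ifP => _; have := eta0; lra.
Qed.

Definition perturbed_dist : fin_dist R n :=
  FinDist perturbedxx perturbed_positivity perturbed_sym perturbed_triangle.

End perturbed_dist.

(** The reason why the limit pyramid contains every X: a parameter of X, rounded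
to boundedly many points of X and made constant on the blocks, is the parameter
of a finite space whose bounded distances fit below those of d. *)
Lemma box_uniform_space {R : realType} (X : mmspace R) (e : R) : 0 < e ->
  exists (n0 : nat) (M : R), forall (n : nat) (d : fin_dist R n),
    (n0 <= n)%N -> (forall i j, i != j -> M <= d i j) ->
    exists2 Y, lip_le Y (uniform_space d) & (box X Y <= e%:E)%E.
Proof.
move=> e0; have e3 : 0 < e / 3 by rewrite divr_gt0.
have [phi par] := parameter_exists X; have [mphi _] := par.
have [u uP] := dense_sequence (@mm_separable _ X).
have [cX [mcX cXP]] := @borel_quantization _ X u (e / 3) (fun y => uP y _ e3).
pose c := cX \o phi.
have mc i : measurable (I01 `&` c @^-1` [set i]).
  exact: (mphi measurable_I01 _ (mcX i)).
have [N [delta [K [delta0 mK KI Ke [cN cK]]]]] :=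
  nat_valued_almost_uniform e0 mc.
pose B := \sum_(i < N.+1) mdist (u 0%N) (u i).
have uB i : (i <= N)%N -> mdist (u 0%N) (u i) <= B.
  move=> iN; rewrite /B (bigD1 (Ordinal (iN : (i < N.+1)%N)))//= lerDl.
  by apply: sumr_ge0 => j _; exact: mdist_ge0.
exists (Num.truncn delta^-1), (B + B + e) => n d n0n dM.
have ndelta : n.+1%:R^-1 < delta.
  rewrite invf_plt ?posrE// (lt_le_trans (truncnS_gt _))// ler_nat.
  exact: n0n.
(* The common value of c on the part of K in the i-th block; blocks that miss
   K may go anywhere, here to u 0. *)
pose q (i : 'I_n.+1) : nat :=
  if pselect (exists2 s, K s & block n s = i) is left H then c (s2val (cid2 H))
  else 0%N.
have qN i : (q i <= N)%N.
  by rewrite /q; case: pselect => // H; case: (cid2 H) => s Ks /= _; exact: cN.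
have qc s : K s -> q (block n s) = c s.
  move=> Ks; rewrite /q; case: pselect => [H|[]]; last by exists s.
  case: (cid2 H) => t Kt /= ts; apply: cK => //; apply: lt_trans ndelta.
  by apply: block_close => //; exact: KI.
pose d' := perturbed_dist (u \o q) e3.
exists (uniform_space d').
  apply: uniform_space_lip_le => i j; rewrite /d' /= /perturbed.
  have [->|ij] := eqVneq i j; first by rewrite mdistxx addr0 fdistxx.
  apply: le_trans (dM _ _ ij).
  have := metric_triangle (u (q i)) (u 0%N) (u (q j)).
  have := uB _ (qN i); have := uB _ (qN j).
  rewrite (metric_sym (u (q i)) (u 0%N)) /=; lra.
apply: ereal_inf_lbound; exists e => //; split; first exact: ltW.
exists phi, (fin_block d'), K; split => //; first exact: parameter_fin_block.
move=> s t Ks Kt.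
(* Each of phi s and phi t is within e / 3 of its representative, and the
   perturbation adds at most e / 3. *)
have -> : mdist (fin_block d' s) (fin_block d' t) =
    d' (block n s) (block n t).
  by rewrite fin_mdistE !fin_pointK.
rewrite /d' /= /perturbed /= !qc//.
have := cXP (phi s); have := cXP (phi t).
have := metric_triangle (phi s) (u (c s)) (phi t).
have := metric_triangle (u (c s)) (u (c t)) (phi t).
have := metric_triangle (u (c s)) (phi s) (u (c t)).
have := metric_triangle (phi s) (phi t) (u (c t)).
rewrite (metric_sym (phi s) (u (c s))) (metric_sym (phi t) (u (c t))).
rewrite -/(c s) -/(c t) => h1 h2 h3 h4 h5 h6.
have h7 : 0 <= (if block n s == block n t then 0 else e / 3) <= e / 3.
  by case: ifP; lra.
rewrite ler_norml; move: (if _ then _ else _) h7 => z h7; lra.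
Qed.

(** * Products of mm-spaces *)

(** The type of pairs is renamed so as to carry the maximum metric together
with the topology derived from it. *)
Definition prod_space (R : realType) (T1 T2 : completePMetricType R) :=
  (T1 * T2)%type.

Section product_metric.
Context {R : realType} {T1 T2 : completePMetricType R}.
Implicit Types x y z : prod_space T1 T2.

Definition prod_mdist x y : R := Num.max (mdist x.1 y.1) (mdist x.2 y.2).

Lemma prod_mdistxx x : prod_mdist x x = 0.
Proof. by rewrite /prod_mdist !mdistxx maxxx. Qed.

Lemma prod_mdist_positivity x y : prod_mdist x y = 0 -> x = y.
Proof.
move=> xy0; have : prod_mdist x y <= 0 by rewrite xy0.
rewrite ge_max => /andP[d1 d2]; case: x y d1 d2 {xy0} => [x1 x2] [y1 y2] /=.
move=> d1 d2; congr pair; apply: mdist_positivity; apply/eqP.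
  by rewrite eq_le mdist_ge0 andbT.
by rewrite eq_le mdist_ge0 andbT.
Qed.

Lemma prod_mdist_sym x y : prod_mdist x y = prod_mdist y x.
Proof. by rewrite /prod_mdist metric_sym (metric_sym x.2). Qed.

Lemma prod_mdist_triangle y x z :
  prod_mdist x z <= prod_mdist x y + prod_mdist y z.
Proof.
rewrite ge_max; apply/andP; split.
  apply: le_trans (metric_triangle _ y.1 _) _.
  by apply: lerD; rewrite /prod_mdist le_max lexx.
apply: le_trans (metric_triangle _ y.2 _) _.
by apply: lerD; rewrite /prod_mdist le_max lexx orbT.
Qed.

End product_metric.

HB.instance Definition _ R (T1 T2 : completePMetricType R) :=
  Choice.on (prod_space T1 T2).
HB.instance Definition _ R (T1 T2 : completePMetricType R) :=
  isPointed.Build (prod_space T1 T2) (point, point).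
HB.instance Definition _ (R : realType) (T1 T2 : completePMetricType R) :=
  isMetric.Build R (prod_space T1 T2) (@prod_mdistxx R T1 T2)
    (@prod_mdist_positivity R T1 T2) (@prod_mdist_sym R T1 T2)
    (@prod_mdist_triangle R T1 T2).

Section product_complete.
Context {R : realType} {T1 T2 : completePMetricType R}.

Lemma prod_mdistE (x y : prod_space T1 T2) :
  mdist x y = Num.max (mdist x.1 y.1) (mdist x.2 y.2).
Proof. by []. Qed.

Lemma prod_ballE (x : prod_space T1 T2) (e : R) :
  ball x e = ball x.1 e `*` ball x.2 e.
Proof.
apply/seteqP; split => y; rewrite /setX !ballEmdist/= prod_mdistE gt_max.
  by move/andP.
by move=> [-> ->].
Qed.

Lemma prod_space_complete (F : set_system (prod_space T1 T2)) :
  ProperFilter F -> cauchy F -> cvg F.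
Proof.
move=> PF /cauchyP cF.
have /cvg_ex[l1 Fl1] : cvg (fst @ F).
  apply: cauchy_cvg; apply: cauchy_exP => e e0.
  have [x Fx] := cF e e0; exists x.1.
  suff : F (fst @^-1` ball x.1 e) by []; apply: filterS Fx => y.
  by rewrite prod_ballE => -[].
have /cvg_ex[l2 Fl2] : cvg (snd @ F).
  apply: cauchy_cvg; apply: cauchy_exP => e e0.
  have [x Fx] := cF e e0; exists x.2.
  suff : F (snd @^-1` ball x.2 e) by []; apply: filterS Fx => y.
  by rewrite prod_ballE => -[].
apply/cvg_ex; exists ((l1, l2) : prod_space T1 T2).
move=> A /nbhs_ballP[e /= e0]; rewrite prod_ballE => eA.
have F1 : F (fst @^-1` ball l1 e) by apply: Fl1; exact: nbhsx_ballx.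
have F2 : F (snd @^-1` ball l2 e) by apply: Fl2; exact: nbhsx_ballx.
suff : F A by [].
by apply: filterS2 F1 F2 => y y1 y2; exact: eA.
Qed.

End product_complete.

HB.instance Definition _ (R : realType) (T1 T2 : completePMetricType R) :=
  Uniform_isComplete.Build (prod_space T1 T2) (@prod_space_complete R T1 T2).

Section product_mmspace.
Context {R : realType} (X Y : mmspace R).

Let XY : completePMetricType R := prod_space X Y.

Lemma prod_space_separable : separable XY.
Proof.
have [D cD dD] := @mm_separable _ X; have [D' cD' dD'] := @mm_separable _ Y.
exists (D `*` D'); first exact: countableX.
move=> U [x Ux] oU.
have /nbhs_ballP[e /= e0 eU] : nbhs x U by exact: open_nbhs_nbhs.
have [|y [xy Dy]] := dD (ball x.1 e) _ (open_mball _ _).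
  by exists x.1; exact: ballxx.
have [|z [xz Dz]] := dD' (ball x.2 e) _ (open_mball _ _).
  by exists x.2; exact: ballxx.
by exists (y, z); split => //; apply: eU; rewrite prod_ballE.
Qed.

(** The identity, from the product of the Borel sigma-algebras to the Borel
sigma-algebra of the product. *)
Definition prod_pair (z : borelType X * borelType Y) : borelType XY := z.

(** By separability an open set of the product is a countable union of products
of balls centred on the dense sequences. *)
Lemma measurable_prod_pair : measurable_fun setT prod_pair.
Proof.
have [u uP] := dense_sequence (@mm_separable _ X).
have [v vP] := dense_sequence (@mm_separable _ Y).
apply: measurable_fun_borel => O oO; rewrite setTI.
have -> : prod_pair @^-1` O = \bigcup_m \bigcup_i \bigcup_(j in [set j |
    ball (u i) (2 ^- m) `*` ball (v j) (2 ^- m) `<=` O])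
    (ball (u i) (2 ^- m) `*` ball (v j) (2 ^- m)).
  apply/seteqP; split => [z Oz|z [m _ [i _ [j /= ijO]]]]; last exact: ijO.
  have /nbhs_ballP[e /= e0 eO] : nbhs (z : XY) O by exact: open_nbhs_nbhs.
  have [m me] : exists m : nat, 2 ^- m < e / 2 :> R.
    by apply: exp2V_lt; rewrite divr_gt0.
  have m0 : 0 < 2 ^- m :> R by rewrite invr_gt0 exprn_gt0.
  have [i uz] := uP z.1 _ m0; have [j vz] := vP z.2 _ m0.
  exists m => //; exists i => //; exists j; last first.
    by split => /=; rewrite ballEmdist.
  move=> w [/= w1 w2]; apply: eO; rewrite prod_ballE.
  move: w1 w2. rewrite !ballEmdist /= => w1 w2.
  split.
    apply: le_lt_trans (metric_triangle _ (u i) _) _.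
    by rewrite metric_sym; move: (2 ^- m) w1 uz me => a; lra.
  apply: le_lt_trans (metric_triangle _ (v j) _) _.
  by rewrite metric_sym; move: (2 ^- m) w2 vz me => a; lra.
apply: bigcupT_measurable => m; apply: bigcupT_measurable => i.
apply: bigcup_measurable => j _; apply: measurableX;
  exact: measurable_ball_borel.
Qed.

HB.instance Definition _ := @isMeasurableFun.Build _ _ _ _ prod_pair
  measurable_prod_pair.

Definition prod_law : probability (borelType XY) R :=
  distribution (mm_measure X \x mm_measure Y)%E prod_pair.

Lemma prod_law_setX (A : set (borelType X)) (B : set (borelType Y)) :
  measurable A -> measurable B ->
  prod_law (A `*` B) = (mm_measure X A * mm_measure Y B)%E.
Proof. exact: product_measure1E. Qed.

Lemma mm_measure_ball_gt0 (Z : mmspace R) (z : Z) (e : R) : 0 < e ->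
  (0 < mm_measure Z (ball z e))%E.
Proof.
move=> e0; have : msupp (mm_measure Z) z by rewrite mm_supp.
by apply; [exact: open_mball|exact: ballxx].
Qed.

Lemma prod_law_supp : msupp prod_law = setT.
Proof.
apply/seteqP; split => // x _ U oU Ux.
have /nbhs_ballP[e /= e0 eU] : nbhs x U by exact: open_nbhs_nbhs.
apply: (@lt_le_trans _ _ (prod_law (ball x.1 e `*` ball x.2 e))).
  rewrite prod_law_setX; [|exact: measurable_ball_borel..].
  by rewrite mule_gt0//; exact: mm_measure_ball_gt0.
rewrite -prod_ballE in eU *; apply: le_measure; rewrite ?inE//.
  by exact: measurable_ball_borel.
exact: (open_borel oU).
Qed.

Definition prod_mmspace : mmspace R :=
  MMSpace prod_space_separable prod_law_supp.

Lemma lip_le_prod_fst : lip_le X prod_mmspace.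
Proof.
exists (fst : XY -> X); split => [x y|A mA].
  by rewrite prod_mdistE le_max lexx.
rewrite -[LHS]/(prod_law (fst @^-1` A)).
have -> : (fst @^-1` A : set XY) = A `*` setT.
  by apply/seteqP; split => x //= [].
by rewrite prod_law_setX// probability_setT mule1.
Qed.

Lemma lip_le_prod_snd : lip_le Y prod_mmspace.
Proof.
exists (snd : XY -> Y); split => [x y|A mA].
  by rewrite prod_mdistE le_max lexx orbT.
rewrite -[LHS]/(prod_law (snd @^-1` A)).
have -> : (snd @^-1` A : set XY) = setT `*` A.
  by apply/seteqP; split => x //= [].
by rewrite prod_law_setX// probability_setT mul1e.
Qed.

End product_mmspace.

(** * Weak convergence to the pyramid of all mm-spaces *)

Lemma cvge0_nneg {R : realType} (u : nat -> \bar R) :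
  (forall n, (0 <= u n)%E) ->
  (forall e : R, 0 < e -> \forall n \near \oo, (u n <= e%:E)%E) ->
  u n @[n --> \oo] --> 0%E.
Proof.
move=> u0 ue; have ufin e : 0 < e -> \forall n \near \oo,
    u n \is a fin_num /\ 0 <= fine (u n) <= e.
  move=> /ue; apply: filterS => n une.
  have fn : u n \is a fin_num.
    by rewrite ge0_fin_numE// (le_lt_trans une)// ltry.
  by split => //; rewrite -!lee_fin fineK// u0.
apply/fine_cvgP; split; first by apply: filterS (ufin 1 ltr01) => n [].
apply/cvgrPdist_le => e e0; apply: filterS (ufin e e0) => n [_ /andP[h0 he]].
by rewrite sub0r normrN ger0_norm.
Qed.

Lemma box_to_ge0 {R : realType} (X : mmspace R) (P : set (mmspace R)) :
  (0 <= box_to X P)%E.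
Proof.
apply: le_ereal_inf_tmp => _ [Y _ <-].
by apply: le_ereal_inf_tmp => _ [e [e0 _] <-]; rewrite lee_fin.
Qed.

Lemma pyramid_setT {R : realType} : pyramid (setT : set (mmspace R)).
Proof.
split => // [X X' _ _|]; last first.
  by exists (uniform_space (perturbed_dist (fun _ : 'I_1 => 0 : R^o) ltr01)).
exists (prod_mmspace X X'); split => //.
  exact: lip_le_prod_fst.
exact: lip_le_prod_snd.
Qed.

Lemma weak_cvg_setT {R : realType} (N : nat -> nat)
    (d : forall n, fin_dist R (N n)) :
  (forall n, (n <= N n)%N) ->
  (forall n i j, i != j -> n%:R <= d n i j) ->
  weak_cvg (fun n => pyramid_of (uniform_space (d n))) setT.
Proof.
move=> nN nd; split => [X _|X /(_ I)//].
apply: cvge0_nneg => [n|e e0]; first exact: box_to_ge0.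
have [n0 [M H]] := box_uniform_space X e0.
near=> n.
have [||Y YX Ye] := H (N n) (d n).
- by apply: leq_trans (nN n); near: n; exact: nbhs_infty_ge.
- move=> i j ij; apply: le_trans (nd n _ _ ij).
  by near: n; exact: nbhs_infty_ger.
by apply: le_trans Ye; apply: ereal_inf_lbound; exists Y.
Unshelve. all: by end_near. Qed.

(** * Lower bound on the observable distance *)

Section simplex.
Context {R : realType} (n : nat) (D : R) (D0 : 0 < D).

(** The perturbation of a constant map: the equilateral distance of edge D. *)
Definition simplex : fin_dist R n :=
  perturbed_dist (fun _ => 0 : R^o) D0.

Lemma simplexE i j : simplex i j = if i == j then 0 else D.
Proof. by rewrite /= /perturbed mdistxx add0r. Qed.

End simplex.

Lemma parameter_measurable_comp {R : realType} n (d : fin_dist R n)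
    (phi : R -> uniform_space d) (f : uniform_space d -> R) :
  parameter phi -> measurable_fun I01 (f \o phi).
Proof.
move=> [mphi _] _ A _; apply: (mphi measurable_I01 (f @^-1` A)).
exact: measurable_fin_space.
Qed.

Section half_mass.
Context {R : realType} (n : nat).
Local Notation N := (n.*2.+1).

Let block_bounds (s : R) : I01 s ->
  (block N s)%:R <= s * (n.+1%:R + n.+1%:R) < (block N s).+1%:R.
Proof.
move=> sI; have : (I01 `&` block N @^-1` [set block N s]) s by [].
rewrite block_itv /= in_itv/= ler_pdivrMr// ltr_pdivlMr//.
by rewrite -natrD addnn.
Qed.

Lemma lower_half_mass (d : fin_dist R N) (psi : R -> uniform_space d) :
  parameter psi ->
  ((2^-1)%:E <= lebesgue_measure
    (I01 `&` [set s | (fin_index (psi s : fin_space d) < n.+1)%N]))%E.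
Proof.
move=> par; have mA := @measurable_fin_space _ _ d
  [set x | (fin_index x < n.+1)%N].
rewrite [leRHS](par.2 _ mA) -(parameter_fin_block d).2//.
have -> : (2^-1)%:E = lebesgue_measure (`[0, 2^-1[%classic : set R).
  by rewrite lebesgue_measure_itv/= lte_fin invr_gt0 ltr0n -EFinB subr0.
apply: le_measure; rewrite ?inE//.
  exact: ((parameter_fin_block d).1 measurable_I01 _ mA).
move=> s; rewrite /= in_itv/= => /andP[s0 s1].
have sI : I01 s by rewrite /I01/= in_itv/= s0 (lt_trans s1)// invf_lt1// ltr1n.
split => //=; rewrite -(ltr_nat R).
by have := block_bounds sI; move: (n.+1%:R) (ltr0Sn R n) => a; nra.
Qed.

Lemma upper_half_mass (d : fin_dist R N) (psi : R -> uniform_space d) :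
  parameter psi ->
  ((2^-1)%:E <= lebesgue_measure
    (I01 `&` [set s | (n.+1 <= fin_index (psi s : fin_space d))%N]))%E.
Proof.
move=> par; have mA := @measurable_fin_space _ _ d
  [set x | (n.+1 <= fin_index x)%N].
rewrite [leRHS](par.2 _ mA) -(parameter_fin_block d).2//.
have -> : (2^-1)%:E = lebesgue_measure (`[2^-1, 1[%classic : set R).
  rewrite lebesgue_measure_itv/= lte_fin invf_lt1// ltr1n -EFinB.
  by congr EFin; lra.
apply: le_measure; rewrite ?inE//.
  exact: ((parameter_fin_block d).1 measurable_I01 _ mA).
move=> s; rewrite /= in_itv/= => /andP[s0 s1].
have sI : I01 s by rewrite /I01/= in_itv/= s1 andbT (le_trans _ s0).
split => //=; rewrite -ltnS -(ltr_nat R).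
by have := block_bounds sI; move: (n.+1%:R) (ltr0Sn R n) => a; nra.
Qed.

End half_mass.

(** The 1-Lipschitz function equal to 0 on one half of the points and to E on
the other oscillates by E, while on the other space 1-Lipschitz functions
oscillate by at most D. Two functions that are e-close in measure with e < 1/2
are e-close at some point of each half, hence E <= D + 2 e, which excludes
e < 1/4. *)
Lemma dconc_simplex_ge {R : realType} (n : nat) (D E : R)
    (D0 : 0 < D) (E0 : 0 < E) : D + 2^-1 <= E ->
  ((4^-1)%:E <= dconc (uniform_space (simplex n.*2.+1 D0))
                      (uniform_space (simplex n.*2.+1 E0)))%E.
Proof.
move=> DE; apply: le_ereal_inf_tmp => _ [phi [psi [pphi ppsi ->]]].
set dX := simplex _ D0 in phi pphi *; set dY := simplex _ E0 in psi ppsi *.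
rewrite /hausdorff_me le_max; apply/orP; right.
pose g (y : fin_space dY) : R := if (fin_index y < n.+1)%N then 0 else E.
have gL : @Lip1 R (uniform_space dY) g.
  move=> x y; rewrite fin_mdistE simplexE /g.
  have [->|_] := eqVneq; first by rewrite subrr normr0.
  by case: ifP; case: ifP => _ _; rewrite ler_norml; lra.
apply: (@le_trans _ _
  (ereal_inf [set me f (g \o psi) | f in pullback_Lip1 phi])).
  2: by apply: ereal_sup_ubound; exists (g \o psi) => //; exists g.
apply: le_ereal_inf_tmp => _ [_ [f fL <-] <-].
apply: le_ereal_inf_tmp => _ [e [e0 fge] <-]; rewrite lee_fin leNgt.
apply/negP => e4.
set S := [set s | _] in fge.
have mS : measurable S.
  have mfg : measurable_fun I01 (fun s => `|(f \o phi) s - (g \o psi) s|).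
    apply: measurableT_comp => //; apply: measurable_funB.
      exact: parameter_measurable_comp.
    exact: (@parameter_measurable_comp _ _ dY).
  have := mfg measurable_I01 `]e, +oo[%classic (measurable_itv _).
  congr measurable; apply/seteqP; split => s [sI] /=.
    by rewrite in_itv/= andbT.
  by move=> es; split => //=; rewrite in_itv/= andbT.
have off (A : set (fin_space dY)) :
    ((2^-1)%:E <= lebesgue_measure (I01 `&` psi @^-1` A))%E ->
    exists2 s, A (psi s) & `|f (phi s) - g (psi s)| <= e.
  move=> mA; apply: contrapT => nex.
  suff : ((2^-1)%:E <= e%:E :> \bar R)%E by rewrite lee_fin; lra.
  apply: le_trans mA _; apply: le_trans fge; apply: le_measure; rewrite ?inE//.
    exact: (ppsi.1 measurable_I01 _ (measurable_fin_space _)).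
  move=> s [sI As]; split => //=; rewrite ltNge; apply/negP => fe.
  by apply: nex; exists s.
have [s /= Ls fs] := off [set y | (fin_index y < n.+1)%N]
  (lower_half_mass ppsi).
have [t /= Ut ft] := off [set y | (n.+1 <= fin_index y)%N]
  (upper_half_mass ppsi).
have := fL (phi s) (phi t); rewrite fin_mdistE simplexE.
have : (if fin_index (phi s) == fin_index (phi t) then 0 else D) <= D.
  by case: ifP => _ //; exact: ltW.
move: fs ft; rewrite /g Ls ltnNge Ut /= !ler_norml; lra.
Qed.

(** * The two sequences *)

Theorem proposition1p3 (R : realType) :
  exists X Y : nat -> mmspace R,
    (0 < ereal_inf (range (fun n => dconc (X n) (Y n))))%E /\
    exists P : set (mmspace R),
      [/\ pyramid P,
          weak_cvg (fun n => pyramid_of (X n)) P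
        & weak_cvg (fun n => pyramid_of (Y n)) P].
Proof.
have D0 n : 0 < n.+1%:R :> R by [].
have E0 n : 0 < n.+2%:R :> R by [].
exists (fun n => uniform_space (simplex n.*2.+1 (D0 n))).
exists (fun n => uniform_space (simplex n.*2.+1 (E0 n))).
have leN n : (n <= n.*2.+1)%N by rewrite -addnn -addnS leq_addr.
split.
  apply: (@lt_le_trans _ _ (4^-1)%:E); first by rewrite lte_fin.
  apply: le_ereal_inf_tmp => _ [n _ <-]; apply: dconc_simplex_ge.
  by rewrite -[n.+2%:R]natr1 lerD2l invf_le1// ler1n.
exists setT; split; first exact: pyramid_setT.
- apply: weak_cvg_setT => // n i j ij; rewrite simplexE (negPf ij) ler_nat.
  exact: leqnSn.
- apply: weak_cvg_setT => // n i j ij; rewrite simplexE (negPf ij) ler_nat.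
  by rewrite (leq_trans (leqnSn _)).
Qed.
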